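(* Let $k,n$ be natural numbers with $1<k<n$. Then the graph of pyramids $T_{n,k}=K_k\lor\overline{K_{n-k}}$ is determined by its spectrum; that is, every graph $G$ that is cospectral with $T_{n,k}$ is isomorphic to $T_{n,k}$.
   Context: All graphs are finite, simple and undirected. $K_m$ is the complete graph on $m$ vertices and $\overline{K_m}$ is the empty graph (no edges) on $m$ vertices. The join $G_1\lor G_2$ is obtained from the disjoint union of $G_1$ and $G_2$ by connecting every vertex of $G_1$ to every vertex of $G_2$. For natural numbers $k<n$, $T_{n,k}:=K_k\lor\overline{K_{n-k}}$; for $k>1$ it is called a graph of pyramids. The spectrum $\sigma(G)$ of a graph $G$ is the multiset of eigenvalues (with multiplicity) of its $(0,1)$ adjacency matrix. Two graphs are cospectral if they have the same spectrum. A graph is determined by its spectrum (DS) if every graph cospectral with it is isomorphic to it. *)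

(* Defs.v *)
From HB Require Import structures.
From mathcomp Require Import all_boot all_order all_algebra all_field.
From mathcomp Require Import finmap multiset.

Set Implicit Arguments.
Unset Strict Implicit.
Unset Printing Implicit Defensive.

Import GRing.Theory.
Local Open Scope ring_scope.

Record sgraph := SGraph {
  vertex : finType;
  adj : rel vertex;
  adj_sym : symmetric adj;
  adj_irr : irreflexive adj }.

Definition isomorphic (G H : sgraph) : Prop :=
  exists2 f : vertex G -> vertex H,
    bijective f & forall x y, adj (f x) (f y) = adj x y.

Section Complete.
Variable m : nat.

Lemma complete_sym : symmetric (fun x y : 'I_m => x != y).
Proof. by move=> x y; rewrite eq_sym. Qed.

Lemma complete_irr : irreflexive (fun x y : 'I_m => x != y).
Proof. by move=> x; rewrite eqxx. Qed.

Definition complete : sgraph := SGraph complete_sym complete_irr.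

Definition edgeless : sgraph :=
  @SGraph 'I_m (fun _ _ => false) (fun _ _ => erefl) (fun _ => erefl).

End Complete.

Section Join.
Variables G1 G2 : sgraph.

Definition join_adj (x y : vertex G1 + vertex G2) : bool :=
  match x, y with
  | inl a, inl b => adj a b
  | inr a, inr b => adj a b
  | _, _ => true
  end.

Lemma join_sym : symmetric join_adj.
Proof. by move=> [x|x] [y|y] //=; rewrite adj_sym. Qed.

Lemma join_irr : irreflexive join_adj.
Proof. by move=> [x|x] /=; rewrite adj_irr. Qed.

Definition join : sgraph := SGraph join_sym join_irr.

End Join.

Definition pyramid (n k : nat) : sgraph :=
  join (complete k) (edgeless (n - k)).

(* The vertices are numbered by [enum_val]; the numbering does not affect the
   spectrum. *)
Definition adjmx (G : sgraph) : 'M[algC]_#|vertex G| :=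
  \matrix_(i, j) (adj (enum_val i) (enum_val j))%:R.

(* The roots of the characteristic polynomial, each repeated according to its
   multiplicity. The adjacency matrix has integer entries, so all its
   eigenvalues are algebraic numbers. *)
Definition spectrum (G : sgraph) : {mset algC}%mset :=
  seq_mset (sval (closed_field_poly_normal (char_poly (adjmx G)))).

Definition cospectral (G H : sgraph) : Prop := spectrum G = spectrum H.

Definition determined_by_spectrum (G : sgraph) : Prop :=
  forall H : sgraph, cospectral H G -> isomorphic H G.

Lemma char_poly_spectrum (G : sgraph) :
  char_poly (adjmx G) = \prod_(a <- spectrum G) ('X - a%:P).
Proof.
rewrite /spectrum; case: closed_field_poly_normal => r /= ->.
rewrite (monicP (char_poly_monic _)) scale1r.
by apply/perm_big; rewrite perm_sym perm_eq_seq_mset.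
Qed.

Lemma mem_spectrum (G : sgraph) (a : algC) :
  (a \in spectrum G) = eigenvalue (adjmx G) a.
Proof.
rewrite eigenvalue_root_char char_poly_spectrum root_prod_XsubC.
by [].
Qed.

(* Main.v *)
(** Cospectral graphs have unitarily similar adjacency matrices, since both
    matrices are normal. Hence the adjacency matrix A of a graph H cospectral
    with T_{n,k} inherits from T_{n,k} four facts: its Hermitian form is
    nonpositive on some hyperplane, rank A <= k + 1, rank (A + I) <= n - k + 1,
    and tr A^2 is the same.

    The first fact excludes 2K_2, P_4 and the paw as induced subgraphs, so H is
    complete multipartite up to isolated vertices. In such a graph every vector
    of ker (A + I) has coordinate sum zero and is supported on the vertices
    adjacent to all other non-isolated vertices, so the third fact yields at
    least k such vertices. Keep k of them. Two adjacent vertices outside would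
    give a clique on k + 2 vertices, contradicting the second fact. So H embeds
    in T_{n,k}, and having as many edges it is T_{n,k}. *)

Require Import Defs.
From mathcomp Require Import all_boot all_order all_fingroup all_algebra all_field.
From mathcomp Require Import ring zify.

Set Implicit Arguments.
Unset Strict Implicit.
Unset Printing Implicit Defensive.

Import Order.TTheory GRing.Theory Num.Theory.
Local Open Scope ring_scope.
Local Open Scope sesquilinear_scope.

(** * Unitary similarity of normal matrices *)

Lemma char_poly_conj (F : fieldType) n (P A : 'M[F]_n) :
  P \in unitmx -> char_poly (invmx P *m A *m P) = char_poly A.
Proof.
move=> Pu; rewrite /char_poly /char_poly_mx.
have PVP : map_mx polyC (invmx P) *m map_mx polyC P = 1%:M.
  by rewrite -[LHS]map_mxM mulVmx // map_mx1.
have -> : 'X%:M - map_mx polyC (invmx P *m A *m P) =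
    map_mx polyC (invmx P) *m ('X%:M - map_mx polyC A) *m map_mx polyC P.
  rewrite !map_mxM mulmxBr mulmxBl scalar_mxC -(mulmxA 'X%:M).
  by rewrite PVP mulmx1.
by rewrite !det_mulmx mulrAC -det_mulmx PVP det1 mul1r.
Qed.

(** By the spectral theorem both matrices are unitarily diagonalizable. Equal characteristic
    polynomials make one diagonal a permutation of the other, and permutation matrices are
    unitary. *)
Lemma normal_char_poly_unitary n (A B : 'M[algC]_n) :
    A \is normalmx -> B \is normalmx -> char_poly A = char_poly B ->
  exists2 U, U \is unitarymx & B = U^t* *m A *m U.
Proof.
move=> /orthomx_spectralP; set P := spectralmx A; set d := spectral_diag A => eA.
move=> /orthomx_spectralP; set Q := spectralmx B; set c := spectral_diag B => eB.
have Pu : P \is unitarymx := spectral_unitarymx A.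
have Qu : Q \is unitarymx := spectral_unitarymx B.
rewrite eA eB !char_poly_conj ?unitarymx_unit //.
rewrite !char_poly_trig ?diag_mx_is_trig //.
under eq_bigr do rewrite mxE eqxx mulr1n.
under [RHS]eq_bigr do rewrite mxE eqxx mulr1n.
rewrite -(big_map (fun i => d 0 i) xpredT (fun a => 'X - a%:P)).
rewrite -(big_map (fun i => c 0 i) xpredT (fun a => 'X - a%:P)).
move=> /prod_XsubC_eq; rewrite perm_sym.
have toT (e : 'rV[algC]_n) : [seq e 0 i | i <- index_enum 'I_n] = [tuple e 0 i | i < n].
  by rewrite /= /index_enum -enumT.
rewrite !toT.
case/tuple_permP=> s es.
have cE i : c 0 i = d 0 (s i).
  have /(congr1 (fun x => nth 0 x i)) := es.
  have /= := fun e : 'I_n -> algC => tnth_nth 0 [tuple e i | i < n] i.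
  by move=> h; rewrite -!h !tnth_mktuple.
have dE : diag_mx c = (perm_mx s) *m diag_mx d *m (perm_mx s)^T.
  rewrite tr_perm_mx -row_permE -col_permE.
  apply/matrixP=> i j; rewrite !mxE cE.
  by rewrite (inj_eq perm_inj).
have sE : (perm_mx s : 'M[algC]_n)^t* = (perm_mx s)^T.
  by rewrite tr_perm_mx map_perm_mx.
have su : (perm_mx s : 'M[algC]_n) \is unitarymx.
  apply/unitarymxP.
  by rewrite sE tr_perm_mx -perm_mxM mulgV perm_mx1.
(* Here A = P^t* diag(d) P and B = Q^t* diag(c) Q, while diag(c) = S diag(d) S^T for the permutation
   matrix S of [s]. *)
exists (P^t* *m (perm_mx s)^T *m Q).
  by rewrite !mul_unitarymx ?trmxC_unitary // -sE ?trmxC_unitary.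
rewrite dE !invmx_unitary // !trmx_mul !map_mxM !trmxCK trmxK map_perm_mx.
rewrite !mulmxA mulmxtVK // -!(mulmxA (_ *m diag_mx d)) !mulmxA.
by rewrite -(mulmxA _ P) (unitarymxP Pu) mulmx1.
Qed.

(** * Rank bounds *)

Lemma mxrank_le_card_sum (F : fieldType) m n p (I : finType) (S : {set I})
    (A : 'M[F]_(m, n)) (B : I -> 'M[F]_(p, n)) :
  (A <= \sum_(j in S) <<B j>>)%MS -> (\rank A <= \sum_(j in S) \rank (B j))%N.
Proof.
move=> /mxrankS/leq_trans; apply.
elim/big_rec2: _ => [|j r M _ IH]; first by rewrite mxrank0.
by rewrite (leq_trans (mxrank_adds_leqif _ _)) // leq_add // mxrank_gen.
Qed.

Lemma mxrank_le_distinct_rows (F : fieldType) m n (S : {set 'I_m})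
    (A : 'M[F]_(m, n)) :
  (forall i, exists2 j, j \in S & row i A = row j A) -> (\rank A <= #|S|)%N.
Proof.
move=> AS; have AleS : (A <= \sum_(j in S) <<row j A>>)%MS.
  apply/row_subP=> i; have [j jS ->] := AS i.
  by rewrite (sumsmx_sup j) // genmxE.
apply: leq_trans (mxrank_le_card_sum AleS) _.
by rewrite -sum1_card leq_sum // => j _; rewrite rank_leq_row.
Qed.

Lemma mxrank_mxsub (F : fieldType) m n p q (f : 'I_p -> 'I_m) (g : 'I_q -> 'I_n)
  (A : 'M[F]_(m, n)) : (\rank (mxsub f g A) <= \rank A)%N.
Proof.
rewrite -(mul1mx A) mxsub_mul (leq_trans (mxrankM_maxr _ _)) //.
by rewrite mul1mx -[A in colsub _ A]mulmx1 -mulmx_colsub mxrankM_maxl.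
Qed.

(** With J the all-ones matrix, J^2 = (m+2)J, so the inverse is J/(m+1) - I. *)
Lemma unitmx_ones_minus_scalar (F : numFieldType) m :
  const_mx 1 - 1%:M \in @unitmx F m.+2.
Proof.
set J : 'M[F]_m.+2 := const_mx 1.
have JJ : J *m J = m.+2%:R *: J.
  apply/matrixP=> i j; rewrite !mxE mulr1.
  under eq_bigr do rewrite !mxE mulr1.
  by rewrite sumr_const card_ord.
suff : (J - 1%:M) *m (m.+1%:R^-1 *: J - 1%:M) = 1%:M by case/mulmx1_unit.
rewrite mulmxBr mulmxBl -!scalemxAr mulmx1 mul1mx JJ -scalerBr.
rewrite -{2}(scale1r J) -scalerBl scalerA -(natr1 m.+1) addrK mulVf ?pnatr_eq0 //.
by rewrite scale1r subKr.
Qed.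

(** * Matrices of relations and the model of the graph of pyramids *)

Section RelMx.
Variable n : nat.
Implicit Types (e : rel 'I_n) (D : {set 'I_n}).

Definition rel_mx e : 'M[algC]_n := \matrix_(i, j) (e i j)%:R.

(** The graph of pyramids on ['I_n], with [D] as its complete part. Leaving [D] arbitrary
    accommodates any numbering of the vertices. *)
Definition split_rel D : rel 'I_n :=
  fun i j => (i != j) && ((i \in D) || (j \in D)).

Lemma rel_mx_tr e : symmetric e -> (rel_mx e)^T = rel_mx e.
Proof. by move=> es; apply/matrixP=> i j; rewrite !mxE es. Qed.

Lemma rel_mx_normal e : symmetric e -> rel_mx e \is normalmx.
Proof.
move=> es; apply: symmetric_normalmx.
  by apply/is_hermitianmxP; rewrite scale1r map_mx_id // rel_mx_tr.
by apply/mxOverP=> i j; rewrite mxE realn.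
Qed.

Lemma split_rel_sym D : symmetric (split_rel D).
Proof. by move=> i j; rewrite /split_rel eq_sym orbC. Qed.

(** With d the indicator of [D] and 1 the all-ones column, the matrix is d 1^T + 1 d^T - d d^T -
    diag(d). On vectors orthogonal to d only -diag(d) contributes. *)
Lemma split_form_le0 D (v : 'rV[algC]_n) :
    v *m (\col_i (i \in D)%:R) = 0 ->
  (v *m rel_mx (split_rel D) *m v^t*) 0 0 <= 0.
Proof.
set d : 'cV[algC]_n := \col_i _ => vd0.
have dv0 : d^T *m v^t* = 0.
  have <- : d^t* = d^T by apply/matrixP=> i j; rewrite !mxE conjC_nat.
  by rewrite -map_mxM -trmx_mul vd0 trmx0 map_mx0.
have -> : rel_mx (split_rel D) =
    d *m const_mx 1 + const_mx 1 *m d^T - d *m d^T - diag_mx d^T.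
  apply/matrixP=> i j; rewrite !mxE !big_ord1 !mxE /split_rel.
  have [->|ne] := eqVneq i j; case: (j \in D) => /=;
    try case: (i \in D) => /=; rewrite ?mulr1n ?mulr0n;
    rewrite ?(mul0r, mulr0, mulr1, addr0, subr0, add0r, addrK, subrr, oppr0) //.
rewrite !mulmxBr !mulmxDr !mulmxBl !mulmxDl !mulmxA vd0 !mul0mx add0r.
rewrite -!mulmxA dv0 !mulmx0 subr0 sub0r mulmxA mxE oppr_le0 mxE.
apply: sumr_ge0 => i _; rewrite mul_mx_diag !mxE mulrAC.
by rewrite mulr_ge0 ?mul_conjC_ge0 ?ler0n.
Qed.

Lemma trace_rel_mx_sq e : symmetric e ->
  \tr (rel_mx e *m rel_mx e) = (\sum_i \sum_j e i j)%:R.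
Proof.
move=> es; rewrite natr_sum; apply: eq_bigr => i _.
rewrite mxE natr_sum; apply: eq_bigr => j _.
by rewrite !mxE es -natrM mulnb andbb.
Qed.

(** All rows outside [D] coincide, so one of them represents the others. *)
Lemma mxrank_split_rel D : D != setT -> (\rank (rel_mx (split_rel D)) <= #|D|.+1)%N.
Proof.
rewrite -subTset => /subsetPn[x _ xD].
have -> : #|D|.+1 = #|x |: D| by rewrite cardsU1 xD.
apply: mxrank_le_distinct_rows => i.
have [iD|iND] := boolP (i \in D); first by exists i; rewrite ?inE ?iD ?orbT.
exists x; rewrite ?inE ?eqxx //; apply/rowP=> j; rewrite !mxE /split_rel.
rewrite (negPf xD) (negPf iND) /=; congr (_%:R); case: (boolP (j \in D)) => jD.
  have ne y : y \notin D -> y != j by apply: contraNneq => ->.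
  by rewrite !ne.
by rewrite !andbF.
Qed.

(** Adding the identity turns every row indexed by [D] into the all-ones row. *)
Lemma mxrank_split_rel1 D :
  D != set0 -> (\rank (rel_mx (split_rel D) + 1%:M)%R <= #|~: D|.+1)%N.
Proof.
case/set0Pn=> x xD; have -> : #|~: D|.+1 = #|x |: ~: D| by rewrite cardsU1 inE xD.
apply: mxrank_le_distinct_rows => i.
have [iD|iND] := boolP (i \in D); last by exists i; rewrite // !inE iND orbT.
exists x; rewrite ?inE ?eqxx //; apply/rowP=> j; rewrite !mxE /split_rel.
by rewrite xD iD !andbT; do 2![case: eqP => _]; rewrite ?addr0 ?add0r.
Qed.

End RelMx.

(** * Invariants under unitary similarity *)

Section Similar.
Variables (n : nat) (A B U : 'M[algC]_n).
Hypotheses (Uu : U \is unitarymx) (eB : B = U^t* *m A *m U).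

Lemma unitary_mxrank_addC a : \rank (B + a%:M)%R = \rank (A + a%:M)%R.
Proof.
have -> : B + a%:M = U^t* *m (A + a%:M) *m U.
  rewrite mulmxDr mulmxDl -eB scalar_mxC -mulmxA -{2}(trmxCK U).
  by rewrite (unitarymxP _) ?trmxC_unitary // mulmx1.
rewrite mxrankMfree ?row_free_unit ?unitarymx_unit //.
by rewrite eqmxMfull ?row_full_unit ?unitarymx_unit ?trmxC_unitary.
Qed.

Lemma unitary_trace_sq : \tr (B *m B) = \tr (A *m A).
Proof.
rewrite eB !mulmxA mulmxtVK // mxtrace_mulC !mulmxA (unitarymxP Uu).
by rewrite mul1mx.
Qed.

Lemma unitary_form_le0 (w : 'cV[algC]_n) :
    (forall v : 'rV[algC]_n, v *m w = 0 -> (v *m A *m v^t*) 0 0 <= 0) ->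
  forall v : 'rV[algC]_n, v *m (U^t* *m w) = 0 -> (v *m B *m v^t*) 0 0 <= 0.
Proof.
move=> Aw v vw; have := Aw (v *m U^t*).
by rewrite -mulmxA => /(_ vw); rewrite trmx_mul map_mxM trmxCK eB !mulmxA.
Qed.

End Similar.

(** * Definiteness on a plane and forbidden induced subgraphs *)

Lemma form_comb n (A : 'M[algC]_n) (p q : 'rV[algC]_n) a b :
    p^t* = p^T -> q^t* = q^T ->
  let v := a *: p + b *: q in
  (v *m A *m v^t*) 0 0 =
    a * a^* * (p *m A *m p^T) 0 0 + a * b^* * (p *m A *m q^T) 0 0 +
    (b * a^* * (q *m A *m p^T) 0 0 + b * b^* * (q *m A *m q^T) 0 0).
Proof.
move=> pr qr v.
have -> : v^t* = a^* *: p^T + b^* *: q^T.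
  by rewrite -pr -qr; apply/matrixP=> i j; rewrite !mxE rmorphD !rmorphM.
rewrite !mulmxDl -!scalemxAl !mulmxDr -!scalemxAr !scalerDr !scalerA.
by rewrite !mxE.
Qed.

Lemma basis_form n (A : 'M[algC]_n) i j :
  'e_i *m A *m ('e_j)^T = (A i j)%:M :> 'M_1.
Proof.
by rewrite -rowE trmx_delta -colE; apply/matrixP=> k l; rewrite !ord1 !mxE.
Qed.

(** Subtracting 2|b|^2 from the form leaves (2-c)(|a|^2+|b|^2) + c|a+b|^2, which is nonnegative. *)
Lemma hermitian_quadratic_definite (a b : algC) (c : nat) : (c <= 2)%N ->
    a * a^* * 2 + a * b^* * c%:R + (b * a^* * c%:R + b * b^* * 4) <= 0 ->
  a = 0 /\ b = 0.
Proof.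
move=> c2 le0.
have b0 : b = 0.
  apply/eqP; rewrite -mul_conjC_eq0 eq_le mul_conjC_ge0 andbT.
  rewrite -(pmulr_rle0 _ (ltr0n _ 2)); apply: le_trans le0; rewrite -subr_ge0.
  have -> : a * a^* * 2 + a * b^* * c%:R + (b * a^* * c%:R + b * b^* * 4) -
      2 * (b * b^*) = (2 - c)%:R * (a * a^* + b * b^*) + c%:R * ((a + b) * (a + b)^*).
    by rewrite natrB // rmorphD /=; ring.
  by rewrite addr_ge0 // mulr_ge0 ?ler0n ?addr_ge0 ?mul_conjC_ge0.
split=> //; apply/eqP; rewrite -mul_conjC_eq0 eq_le mul_conjC_ge0 andbT.
by rewrite -(pmulr_lle0 _ (ltr0n _ 2)); move: le0; rewrite b0 conjC0 !(mul0r, mulr0, addr0).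
Qed.

(* Otherwise x, y, z, t would induce 2K_2, P_4 or the paw; on the span of
   e_x + e_y and 2 e_z + e_t the form would then be positive definite. *)
Lemma form_le0_adj n (e : rel 'I_n) (w : 'cV[algC]_n) :
    symmetric e -> irreflexive e ->
    (forall v : 'rV[algC]_n, v *m w = 0 ->
       (v *m rel_mx e *m v^t*) 0 0 <= 0) ->
  forall x y z t, e x y -> e z t -> e z x || e z y.
Proof.
move=> es ei H x y z t xy zt; apply/norP=> -[/negPf zx /negPf zy].
(* The weight 2 at z makes the form equal to 4 on [q]. With weight 1 it would be only semidefinite
   when t is adjacent to both x and y. *)
pose p : 'rV[algC]_n := 'e_x + 'e_y; pose q : 'rV[algC]_n := 2%:R *: 'e_z + 'e_t.
have pr : p^t* = p^T by apply/matrixP=> i j; rewrite !mxE rmorphD /= !conjC_nat.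
have qr : q^t* = q^T.
  by apply/matrixP=> i j; rewrite !mxE rmorphD rmorphM /= !conjC_nat.
have def a b : a * (p *m w) 0 0 + b * (q *m w) 0 0 = 0 -> a = 0 /\ b = 0.
  move=> abw; apply: (@hermitian_quadratic_definite _ _ (e x t + e y t)%N).
    by case: (e x t); case: (e y t).
  have := H (a *: p + b *: q); rewrite form_comb //.
  have -> : (p *m rel_mx e *m p^T) 0 0 = 2.
    rewrite /p linearD /= !mulmxDl !mulmxDr !basis_form !mxE !ei xy es xy.
    by rewrite !mulr1n addr0 add0r.
  have -> : (p *m rel_mx e *m q^T) 0 0 = (e x t + e y t)%:R.
    rewrite /p /q linearD linearZ /= !mulmxDl !mulmxDr -!scalemxAr !basis_form.
    by rewrite !mxE !(es _ z) zx zy !mulr1n mulr0 !add0r natrD.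
  have -> : (q *m rel_mx e *m p^T) 0 0 = (e x t + e y t)%:R.
    rewrite /p /q linearD /= !mulmxDl !mulmxDr -!scalemxAl !basis_form.
    by rewrite !mxE zx zy !(es t) !mulr1n mulr0 !add0r natrD.
  have -> : (q *m rel_mx e *m q^T) 0 0 = 4.
    rewrite /q linearD linearZ /= !mulmxDl !mulmxDr -!scalemxAr -!scalemxAl.
    rewrite !basis_form.
    by rewrite !mxE (es t z) zt !ei !mulr1n !mulr0 addr0 add0r mulr1 -natrD.
  apply; apply/matrixP=> i j; rewrite !ord1 mulmxDl -!scalemxAl.
  by move: abw; rewrite !mxE.
(* These coefficients put the combination on the hyperplane, so [p *m w] and [q *m w] both vanish.
   Then [p] itself lies on the hyperplane, a contradiction. *)
have [/eqP qw /eqP] := def ((q *m w) 0 0) (- (p *m w) 0 0) ltac:(ring).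
rewrite oppr_eq0 => /eqP pw.
have [] := def 1 0; first by rewrite pw mulr0 mul0r addr0.
by move/eqP; rewrite oner_eq0.
Qed.

(** * Vectors of the kernel of A + I *)

Section Kernel.
Variables (V : finType) (e : rel V).
Hypotheses (es : symmetric e) (ei : irreflexive e).
Hypothesis e_adj : forall x y z t, e x y -> e z t -> e z x || e z y.

Definition nonisolated i := [exists j, e i j].

Definition dominating :=
  [set i | nonisolated i && [forall j, nonisolated j && (j != i) ==> e i j]].

(** For non-isolated [i] this is its part in the complete multipartite graph; it contains [i] by
    irreflexivity. *)
Definition nonneighbours i := [set j | nonisolated j & ~~ e i j].

(** If a has a neighbour t and is not adjacent to b, then [e_adj] on an edge b x and the edge a t
    makes x a neighbour of a. *)
Lemma nonneighbours_adj i j :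
  nonisolated i -> j \in nonneighbours i -> e j =1 e i.
Proof.
have sub a b : nonisolated a -> ~~ e b a -> subpred (e b) (e a).
  move=> /existsP[t at_] nba x bx; have := e_adj bx at_.
  by rewrite es (negPf nba).
move=> ni; rewrite inE => /andP[nj nij] x; apply/idP/idP; apply: sub => //.
by rewrite es.
Qed.

Variables (F : numFieldType) (f : V -> F).
Hypothesis ef : forall i, \sum_(j | e i j) f j = - f i.

Lemma ker_isolated i : ~~ nonisolated i -> f i = 0.
Proof.
move=> /existsPn ni; apply/eqP; rewrite -oppr_eq0 -ef big1 // => j.
by rewrite (negPf (ni j)).
Qed.

(** Vertices of one part share their neighbourhood, so [f] is constant on the part. The neighbours
    of [i] contribute [- f i] to the total, whence the predecessor. *)
Lemma ker_nonneighbours i :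
  nonisolated i -> (#|nonneighbours i|.-1)%:R * f i = \sum_j f j.
Proof.
move=> ni; rewrite (bigID (e i)) /= ef.
have -> : \sum_(j | ~~ e i j) f j = \sum_(j in nonneighbours i) f i.
  rewrite (bigID nonisolated) /= [X in _ + X]big1 ?addr0; last first.
    by move=> j /andP[_ /ker_isolated].
  apply: eq_big => [j|j /andP[nij nj]]; first by rewrite inE andbC.
  apply: oppr_inj; rewrite -!ef; apply: eq_bigl => x.
  by apply: nonneighbours_adj; rewrite // inE nj.
have ci : (0 < #|nonneighbours i|)%N.
  by apply/card_gt0P; exists i; rewrite inE ni ei.
by rewrite sumr_const -(prednK ci) mulrS addrA addNr add0r mulr_natl.
Qed.

(* If the sum s were nonzero, ker_nonneighbours would make every f i / s
   nonnegative, and ef would then force f = 0. *)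
Lemma ker_sum0 : \sum_j f j = 0.
Proof.
apply/eqP; apply: contraT => s0; set s := \sum_j f j in s0.
have g_ge0 i : 0 <= f i / s.
  have [/ker_nonneighbours fi|/ker_isolated ->] := boolP (nonisolated i);
    last by rewrite mul0r.
  have : (#|nonneighbours i|.-1)%:R * (f i / s) = 1 by rewrite mulrA fi divff.
  case: _.-1 => [|c] c1; last by rewrite -(pmulr_rge0 _ (ltr0n _ c.+1)) c1 ler01.
  by move/esym/eqP: c1; rewrite mul0r oner_eq0.
suff f0 i : f i = 0 by move: s0; rewrite /s big1 ?eqxx // => i _.
apply/eqP; rewrite -(mulIr_eq0 _ (mulIf (invr_neq0 s0))) eq_le g_ge0 andbT.
rewrite -oppr_ge0 -mulNr -ef mulr_suml.
by apply: sumr_ge0.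
Qed.

(** A non-isolated vertex that is not dominating lies in a part of size at least 2, so its
    coefficient in [ker_nonneighbours] is nonzero while the total is zero. *)
Lemma ker_not_dominating i : i \notin dominating -> f i = 0.
Proof.
rewrite inE; have [ni /=|/ker_isolated //] := boolP (nonisolated i).
case/forallPn=> j; rewrite negb_imply -andbA => /and3P[nj ji nij].
have c2 : (1 < #|nonneighbours i|)%N.
  by rewrite (cardD1 i) inE ni ei (cardD1 j) !inE ji nj nij.
move/eqP: (ker_nonneighbours ni); rewrite ker_sum0 mulf_eq0 pnatr_eq0.
by case: #|_| c2 => [|[|c]] //= _ /eqP.
Qed.

End Kernel.

(** Kernel vectors have sum zero and live on [dominating e], so differences of basis vectors to a
    fixed [k0] span them: the nullity is less than the number of dominating vertices. *)
Lemma card_dominating n (e : rel 'I_n) :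
    symmetric e -> irreflexive e ->
    (forall x y z t, e x y -> e z t -> e z x || e z y) ->
    (\rank (rel_mx e + 1%:M)%R < n)%N ->
  (n < \rank (rel_mx e + 1%:M)%R + #|dominating e|)%N.
Proof.
move=> es ei e_adj; set M := rel_mx e + 1%:M => rM.
have kerP (v : 'rV[algC]_n) : v *m M = 0 -> forall i, \sum_(j | e i j) v 0 j = - v 0 i.
  move=> vM i; move/rowP/(_ i): vM; rewrite mulmxDr mulmx1 !mxE => /eqP.
  rewrite addr_eq0 => /eqP <-; rewrite big_mkcond; apply: eq_bigr => j _.
  by rewrite !mxE es; case: (e j i); rewrite ?mulr1 ?mulr0.
(* If no vertex were dominating, the kernel would be zero, against the rank hypothesis. *)
have [k0 k0K] : exists k0, k0 \in dominating e.
  apply/existsP; apply: contraTT rM => /existsPn noK; rewrite -leqNgt.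
  rewrite -[X in (X <= _)%N]subn0 leq_subCl -mxrank_ker leqn0 mxrank_eq0.
  apply/eqP/row_matrixP=> i; rewrite row0.
  have vM : row i (kermx M) *m M = 0 by apply: sub_kermxP; rewrite row_sub.
  apply/rowP=> j; rewrite [RHS]mxE.
  exact: (ker_not_dominating es ei e_adj (kerP _ vM) (noK j)).
have : (kermx M <= \sum_(j in dominating e :\ k0) <<'e_j - 'e_k0 : 'rV[algC]_n>>)%MS.
  apply/row_subP=> i; set v := row i _.
  have /kerP vM : v *m M = 0 by apply: sub_kermxP; rewrite row_sub.
  have v0 := ker_not_dominating es ei e_adj vM.
  have vs := ker_sum0 es ei e_adj vM.
  have -> : v = \sum_(j in dominating e :\ k0) v 0 j *: ('e_j - 'e_k0).
    transitivity (\sum_j v 0 j *: ('e_j - 'e_k0) : 'rV[algC]_n).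
      under [RHS]eq_bigr do rewrite scalerBr.
      by rewrite sumrB -row_sum_delta -scaler_suml vs scale0r subr0.
    rewrite (bigID (mem (dominating e :\ k0))) /= [X in _ + X]big1 ?addr0 //.
    move=> j; rewrite in_setD1 negb_and negbK => /orP[/eqP->|jK].
      by rewrite subrr scaler0.
    by rewrite v0 // scale0r.
  by apply: summx_sub_sums => j _; rewrite genmxE scalemx_sub.
move/mxrank_le_card_sum; rewrite mxrank_ker => le.
have : (\sum_(j in dominating e :\ k0) \rank ('e_j - 'e_k0 : 'rV[algC]_n)%R <=
        #|dominating e :\ k0|)%N.
  by rewrite -sum1_card leq_sum // => j _; rewrite rank_leq_row.
by move: le; rewrite (cardsD1 k0 (dominating e)) k0K; lia.
Qed.

(** * Cliques and reconstruction of the graph *)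

Lemma card_clique_le_rank n (e : rel 'I_n) (C : {set 'I_n}) :
    irreflexive e -> (1 < #|C|)%N ->
    {in C &, forall x y, x != y -> e x y} ->
  (#|C| <= \rank (rel_mx e))%N.
Proof.
move=> ei C2 Ce; pose f (i : 'I_#|C|) := enum_val i.
apply: leq_trans (mxrank_mxsub f f (rel_mx e)).
(* The principal submatrix on the clique is J - I, invertible from size 2 on. *)
have -> : mxsub f f (rel_mx e) = const_mx 1 - 1%:M.
  apply/matrixP=> i j; rewrite !mxE; have [->|ij] := eqVneq i j.
    by rewrite ei subrr.
  by rewrite Ce ?enum_valP ?(inj_eq enum_val_inj) // subr0.
case: #|C| C2 => [|[|c]] // _.
by rewrite mxrank_unit ?unitmx_ones_minus_scalar.
Qed.

(** The two membership lists contain each boolean equally often, so they are permutations of each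
    other. *)
Lemma perm_of_card_eq n (D E : {set 'I_n}) :
  #|D| = #|E| -> exists s : {perm 'I_n}, forall i, (s i \in E) = (i \in D).
Proof.
move=> DE.
have : perm_eq [tuple i \in D | i < n] [tuple i \in E | i < n].
  have cnt (A : {set 'I_n}) b :
      count_mem b [tuple i \in A | i < n] = if b then #|A| else (n - #|A|)%N.
    rewrite /= count_map; case: b.
      rewrite cardE -size_filter enumT; congr size.
      by apply: eq_filter => i /=; rewrite eqb_id.
    have -> : (n - #|A|)%N = #|~: A| by rewrite [RHS]cardsCs setCK card_ord.
    rewrite cardE -size_filter enumT.
    congr size.
    by apply: eq_filter => i /=; rewrite inE; case: (i \in A).
  by apply/allP=> b _ /=; rewrite !cnt DE.
case/tuple_permP=> s es; exists s => i.
have /(congr1 (fun x => nth false x i)) := es.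
have /= := fun g : 'I_n -> bool => tnth_nth false [tuple g i | i < n] i.
by move=> h; rewrite -!h !tnth_mktuple => ->.
Qed.

Lemma cospectral_split_rel n (e : rel 'I_n) (D : {set 'I_n}) :
    symmetric e -> irreflexive e -> (1 < #|D| < n)%N ->
    char_poly (rel_mx e) = char_poly (rel_mx (split_rel D)) ->
  exists s : {perm 'I_n}, forall i j, split_rel D (s i) (s j) = e i j.
Proof.
move=> es ei /andP[D1 Dn] eq_chi.
have [U Uu eU] := normal_char_poly_unitary (rel_mx_normal (@split_rel_sym _ D))
  (rel_mx_normal es) (esym eq_chi).
have e_adj : forall x y z t, e x y -> e z t -> e z x || e z y.
  apply: (form_le0_adj es ei); apply: unitary_form_le0 eU _ _.
  exact: split_form_le0.
have rk0 : (\rank (rel_mx e) <= #|D|.+1)%N.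
  rewrite -[rel_mx e]addr0 -(raddf0 (@scalar_mx _ n)) (unitary_mxrank_addC Uu eU).
  rewrite raddf0 addr0 mxrank_split_rel //.
  by apply: contraTneq Dn => ->; rewrite cardsT card_ord ltnn.
have cD : (#|D| + #|~: D| = n)%N by rewrite cardsC card_ord.
have rk1 : (\rank (rel_mx e + 1%:M)%R <= #|~: D|.+1)%N.
  rewrite (unitary_mxrank_addC Uu eU) mxrank_split_rel1 // -card_gt0.
  exact: ltnW.
have cK : (#|D| <= #|dominating e|)%N.
  (* Since [#|D|] exceeds 1, [#|~: D|.+1] is below n. *)
  have rn : (\rank (rel_mx e + 1%:M)%R < n)%N by apply: leq_ltn_trans rk1 _; lia.
  by have := card_dominating es ei e_adj rn; lia.
have [K KK cardK] : exists2 K : {set 'I_n}, K \subset dominating e & #|K| = #|D|.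
  have [t [tu <- tK]] := card_geqP cK; exists [set x in t].
    by apply/subsetP=> x; rewrite inE => /tK.
  by rewrite cardsE; apply/card_uniqP.
(* The trace of the squared matrix counts ordered adjacent pairs. *)
have edges : (\sum_i \sum_j e i j = \sum_i \sum_j split_rel D i j)%N.
  apply/eqP; rewrite -(eqr_nat algC) -!trace_rel_mx_sq //; last exact: split_rel_sym.
  by rewrite (unitary_trace_sq Uu eU).
have domK x y : x \in dominating e -> nonisolated e y -> y != x -> e x y.
  by rewrite inE => /andP[_ /forallP/(_ y) h] ny yx; rewrite ny yx in h.
have eK i j : e i j -> (i \in K) || (j \in K).
  move=> eij; apply: contraT; rewrite negb_or => /andP[iK jK].
  have ij : i != j by apply: contraTneq eij => ->; rewrite ei.
  have : (#|i |: (j |: K)| <= \rank (rel_mx e))%N.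
    have cl : {in i |: (j |: K) &, forall x y, x != y -> e x y}.
      have KT x y : x \in K -> y != x -> nonisolated e y -> e x y.
        by move=> /(subsetP KK) xK yx ny; apply: domK.
      have ni : nonisolated e i by apply/existsP; exists j.
      have nj : nonisolated e j by apply/existsP; exists i; rewrite es.
      have nK x : x \in K -> nonisolated e x.
        by move=> /(subsetP KK); rewrite inE => /andP[].
      move=> x y; rewrite !inE.
      move=> /or3P[/eqP->|/eqP->|xK] /or3P[/eqP->|/eqP->|yK] xy //;
        try by rewrite eqxx in xy.
      - by rewrite es KT.
      - by rewrite es.
      - by rewrite es KT.
      - by rewrite KT // eq_sym.
      - by rewrite KT // eq_sym.
      - by rewrite KT ?nK // eq_sym.
    by apply: card_clique_le_rank; rewrite // !cardsU1 !inE negb_or ij iK jK cardK; lia.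
  by rewrite !cardsU1 !inE negb_or ij iK jK cardK; lia.
have [s sK] := perm_of_card_eq cardK.
exists s.
have le i j : (e i j <= split_rel D (s i) (s j))%N.
  rewrite /split_rel !sK (inj_eq perm_inj); case: (boolP (e i j)) => // eij.
  by rewrite eK // andbT lt0b; apply: contraTneq eij => ->; rewrite ei.
have sum_s : (\sum_i \sum_j split_rel D i j =
    \sum_i \sum_j split_rel D (s i) (s j))%N.
  rewrite (reindex_inj (@perm_inj _ s)); apply: eq_bigr => i _.
  by rewrite (reindex_inj (@perm_inj _ s)).
(* An entrywise inequality between families with equal sums is an equality at every entry. *)
have [_] : (\sum_i \sum_j e i j <= \sum_i \sum_j split_rel D (s i) (s j)
    ?= iff [forall i, [forall j, e i j == split_rel D (s i) (s j) :> nat]])%N.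
  apply: leqif_sum => i _; apply: leqif_sum => j _; exact: leqif_eq.
rewrite edges sum_s eqxx => /esym/forallP E i j.
by have /forallP/(_ j) := E i; case: (e i j); case: split_rel.
Qed.

Local Close Scope ring_scope.

(** The degree of the characteristic polynomial is the number of vertices, which identifies [m] with
    [n]. *)
Lemma cospectral_split_rel_bij m n (e : rel 'I_m) (D : {set 'I_n}) :
    symmetric e -> irreflexive e -> 1 < #|D| < n ->
    char_poly (rel_mx e) = char_poly (rel_mx (split_rel D)) ->
  exists2 s : 'I_m -> 'I_n,
    bijective s & forall i j, split_rel D (s i) (s j) = e i j.
Proof.
move=> es ei cD eq_chi.
have mn : m = n by have := congr1 (size \o val) eq_chi; rewrite /= !size_char_poly => -[].
case: n / mn D cD eq_chi => D cD eq_chi.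
have [s sE] := cospectral_split_rel es ei cD eq_chi.
by exists s => //; exists (s^-1)%g; [exact: permK | exact: permKV].
Qed.

Theorem theorem5p4 (n k : nat) (hk : 1 < k) (hkn : k < n) :
  determined_by_spectrum (pyramid n k).
Proof.
move=> H cosp; set T := pyramid n k.
pose isl (x : vertex T) := if x is inl _ then true else false.
(* [D] holds the numbers of the vertices coming from the complete summand of the join. *)
pose D := [set i : 'I_#|vertex T| | isl (enum_val i)].
have cT : #|vertex T| = n by rewrite card_sum !card_ord subnKC // ltnW.
have cD : #|D| = k.
  have -> : D = [set enum_rank (inl a : vertex T) | a : 'I_k].
    apply/setP=> i; rewrite inE; apply/idP/imsetP => [|[a _ ->]]; last first.
      by rewrite enum_rankK.
    case E: (enum_val i) => [a|//] _; exists a; rewrite // -E.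
    by rewrite enum_valK.
  by rewrite card_imset ?card_ord // => a b /enum_rank_inj [].
have adjT : adjmx T = rel_mx (split_rel D).
  apply/matrixP=> i j; rewrite !mxE /split_rel !inE -(inj_eq enum_val_inj).
  by case: (enum_val i) => a; case: (enum_val j) => b; rewrite ?andbT ?andbF.
have [s s_bij sE] : exists2 s : 'I_#|vertex H| -> 'I_#|vertex T|,
    bijective s & forall i j,
      split_rel D (s i) (s j) = adj (enum_val i : vertex H) (enum_val j).
  apply: cospectral_split_rel_bij.
  - by move=> i j; apply: adj_sym.
  - by move=> i; apply: adj_irr.
  - by rewrite cD hk cT.
  - by rewrite -adjT !char_poly_spectrum cosp.
exists (fun x => enum_val (s (enum_rank x))).
  by apply: (bij_comp (@enum_val_bij _)) (bij_comp s_bij (@enum_rank_bij _)).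
move=> x y; rewrite -[in RHS](enum_rankK x) -[in RHS](enum_rankK y) -sE.
have /matrixP/(_ (s (enum_rank x)) (s (enum_rank y))) := adjT.
by rewrite !mxE => /eqP; rewrite eqr_nat; case: adj; case: split_rel.
Qed.
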